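(* Let $G=(V,E)$ be a connected graph with $n=|V|$, and let $r,r_1\in V$ with $rr_1\in E$. Let $D=(V,A)$ be the directed graph obtained from $G$ as follows: every edge $vr\in E$ becomes the arc $(r,v)$; every edge $vr_1\in E$ with $v\neq r$ becomes the arc $(r_1,v)$; every other edge $uv\in E$ is replaced by the two arcs $(u,v)$ and $(v,u)$. Let $C\subseteq V$. Then $C$ is a connected vertex cover of $G$ if and only if there exist $z\in\{0,1\}^A$ and $d\in\mathbb R^V$ such that, with $x=\chi^C\in\{0,1\}^V$, the following hold: (i) $x_u+x_v\geq 1$ for every arc $(u,v)\in A$; (ii) $z(\delta^-(v))=x_v$ for every $v\in V\setminus\{r,r_1\}$; (iii) $d_v\geq n\cdot(z_{uv}-1)+d_u+x_v$ for every arc $(u,v)\in A$; (iv) $d_r=0$; (v) $z(A)=x(V)-1$; (vi) $z_{uv}\leq x_u$ and $z_{uv}\leq x_v$ for every arc $(u,v)\in A$.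
   Context: A set $C\subseteq V$ is a vertex cover of $G$ if every edge of $G$ has at least one endpoint in $C$; it is a connected vertex cover if moreover the induced subgraph $G[C]$ is connected. For $v\in V$, $\delta^-(v)$ is the set of arcs of $A$ with head $v$. For a finite set $A$ and $U\subseteq A$, $\chi^U\in\{0,1\}^A$ is the incidence vector of $U$, and for $x\in\mathbb R^A$, $x(U)=\sum_{a\in U}x_a$. *)

(* Defs.v *)
(* A finite simple graph on T is a symmetric irreflexive
   relation e : rel T. *)
From mathcomp Require Import all_boot all_order all_algebra.
From mathcomp Require Import reals.

Set Implicit Arguments.
Unset Strict Implicit.
Unset Printing Implicit Defensive.

Import Order.TTheory GRing.Theory Num.Theory.
Local Open Scope ring_scope.

(* The graph without vertices counts as connected. *)
Definition connected_graph (T : finType) (e : rel T) : Prop :=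
  forall u v : T, connect e u v.

Definition induced (T : finType) (e : rel T) (C : {set T}) :
    rel {v : T | v \in C} :=
  [rel u v | e (val u) (val v)].
Arguments induced {T} e C.

Definition vertex_cover (T : finType) (e : rel T) (C : {set T}) : Prop :=
  forall u v : T, e u v -> (u \in C) || (v \in C).

Definition connected_vertex_cover (T : finType) (e : rel T) (C : {set T}) :
    Prop :=
  vertex_cover e C /\ connected_graph (induced e C).

(* The edge between r and r1 only yields (r, r1); since e is symmetric, the last
   set contains both orientations of each of its edges. *)
Definition darcs (T : finType) (e : rel T) (r r1 : T) : {set T * T} :=
  [set a | (a.1 == r) && e a.2 r]
  :|: [set a | [&& a.1 == r1, e a.2 r1 & a.2 != r]]
  :|: [set a | [&& e a.1 a.2, a.1 \notin [set r; r1]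
                 & a.2 \notin [set r; r1]]].

Definition darc (T : finType) (e : rel T) (r r1 : T) : finType :=
  {a : T * T | a \in darcs e r r1}.

Definition darc_tail (T : finType) (e : rel T) (r r1 : T) (a : darc e r r1) :
    T :=
  (val a).1.

Definition darc_head (T : finType) (e : rel T) (r r1 : T) (a : darc e r r1) :
    T :=
  (val a).2.

(* \delta^-(v) *)
Definition darcs_in (T : finType) (e : rel T) (r r1 v : T) :
    {set darc e r r1} :=
  [set a | darc_head a == v].

(* \chi^U *)
Definition incidence (R : realType) (I : finType) (U : {set I}) :
    {ffun I -> R} :=
  [ffun i => (i \in U)%:R].

(* x(U) *)
Definition vsum (R : realType) (I : finType) (x : {ffun I -> R})
    (U : {set I}) : R :=
  \sum_(i in U) x i.

(* Main.v *)
(* Given a connected vertex cover C, root a breadth-first tree of G[C] at r if r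
   lies in C and at r1 otherwise (one of them does, as r r1 is an edge); take for
   z the tree arcs and for d the distance to the root, extended by 0 outside C.
   Conversely, by (ii), (iii) and (vi) every vertex v of C other than r, r1 has a
   neighbor u in C with d u < d v, so descending along d reaches r or r1 inside
   C; these two are adjacent, hence G[C] is connected. *)

Require Import Defs.
From mathcomp Require Import all_boot all_order all_algebra.
From mathcomp Require Import reals.
From mathcomp Require Import lra.

Set Implicit Arguments.
Unset Strict Implicit.
Unset Printing Implicit Defensive.

Import Order.TTheory GRing.Theory Num.Theory.
Local Open Scope ring_scope.

(** The rank [f y] is the length of a shortest walk from [x] to [y], so it supplies both the
    potential [d] and, through the last clause, the parents in a breadth-first tree. *)
Lemma connect_rank (T : finType) (e : rel T) (x : T) :
  exists f : T -> nat, f x = 0%N /\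
    forall y, connect e x y -> (f y < #|T|)%N /\
      (y != x -> exists z, [/\ connect e x z, e z y & (f z < f y)%N]).
Proof.
pose P y k := [exists t : k.-tuple T, path e x t && (last x t == y)].
have PI y (p : seq T) : path e x p -> last x p = y -> P y (size p).
  by move=> ep lp; apply/existsP; exists (in_tuple p); rewrite ep lp eqxx.
(* Only lengths below [#|T|] are searched, which is enough because a walk can be shortened to one
   without repeated vertices; a failed search returns [#|T|]. *)
pose f y := find (P y) (iota 0 #|T|).
have fmin y k : (k < #|T|)%N -> P y k -> (f y <= k)%N.
  move=> kT Pk; rewrite leqNgt; apply/negP => kf.
  by have := before_find 0%N kf; rewrite nth_iota // add0n Pk.
have Tgt0 : (0 < #|T|)%N by apply/card_gt0P; exists x.
exists f; split.
  by apply/eqP; rewrite -leqn0; apply: fmin => //; exact: (PI x [::]).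
move=> y /connectP[p ep ->]; case/shortenP: ep => q eq uq _.
have qT : (size q < #|T|)%N.
  by have := max_card (mem (x :: q)); rewrite (card_uniqP uq).
set y' := last x q.
have fT : (f y' < #|T|)%N by apply: leq_ltn_trans (fmin _ _ qT (PI _ _ eq erefl)) qT.
split=> // nyx.
have : P y' (f y').
  have hP : has (P y') (iota 0 #|T|) by rewrite has_find size_iota.
  by have := nth_find 0%N hP; rewrite nth_iota // add0n.
case/existsP => t; case/andP => et /eqP lt.
(* Cutting the last vertex off a shortest walk leaves a walk one step shorter, whose end is the
   required predecessor. The walk is nonempty since [y' != x]. *)
have := size_tuple t; case/lastP: (tval t) et lt => [_ lt|s w].
  by rewrite -lt eqxx in nyx.
rewrite rcons_path last_rcons size_rcons => /andP[es ew] wy sf.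
exists (last x s); split; [by apply/connectP; exists s | by rewrite -wy|].
by rewrite -sf ltnS; apply: fmin; [rewrite (leq_trans _ (ltnW fT)) // -sf|exact: PI].
Qed.

(** Moves connectivity from the subtype of [C] to a relation on [T], so that ranks and parents can
    be total functions on [T]. *)
Lemma induced_connect (T : finType) (e : rel T) (C : {set T})
    (u v : {v : T | v \in C}) :
  connect (induced e C) u v ->
  connect [rel x y | [&& x \in C, y \in C & e x y]] (val u) (val v).
Proof.
case/connectP => p; elim: p u => [u _ ->|w p IH u /= /andP[uw pw] lv].
  exact: connect0.
apply: connect_trans (IH _ pw lv); apply: connect1.
by apply/and3P; split; rewrite ?(valP u) ?(valP w).
Qed.

(** Starting from both orientations of every edge, the construction of [D] only discards those
    entering [r] and those entering [r1] from a vertex other than [r]. *)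
Lemma in_darcs (T : finType) (e : rel T) (e_sym : symmetric e)
    (e_irr : irreflexive e) (r r1 u v : T) (e_rr1 : e r r1) :
  ((u, v) \in darcs e r r1)
  = [&& e u v, v != r & (v == r1) ==> (u == r)].
Proof.
have nr : r1 != r by apply: contraTneq e_rr1 => ->; rewrite e_irr.
rewrite /darcs !inE /= ![e v _]e_sym !negb_or.
have [->|ur] := eqVneq u r; have [->|vr] := eqVneq v r;
  rewrite ?e_irr ?andbF //= ?implybT ?andbT ?orbF.
- by rewrite eq_sym (negPf nr) /= orbF.
have [->|ur1] := eqVneq u r1; have [->|vr1] := eqVneq v r1;
  rewrite ?e_irr ?andbF ?andbT ?orbF //=.
Qed.

Lemma sum_darcs_into (R : realType) (T : finType) (e : rel T) (r r1 : T)
    (z : {ffun darc e r r1 -> R}) :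
  vsum z [set: darc e r r1] = \sum_v vsum z (darcs_in e r r1 v).
Proof.
rewrite /vsum (partition_big (@darc_head T e r r1) predT) //=.
by apply: eq_bigr => v _; apply: eq_bigl => a; rewrite !inE.
Qed.

Section Sufficiency.
Variables (R : realType) (T : finType) (e : rel T).
Hypotheses (e_sym : symmetric e) (e_irr : irreflexive e).
Variables (r r1 : T) (e_rr1 : e r r1) (C : {set T}).
Variables (z : {ffun darc e r r1 -> R}) (d : {ffun T -> R}).
Let x := incidence R C.

Lemma vertex_cover_of_darcs :
  (forall a : darc e r r1, 1 <= x (darc_tail a) + x (darc_head a)) ->
  vertex_cover e C.
Proof.
move=> xcov.
have arc u v : (u, v) \in darcs e r r1 -> (u \in C) || (v \in C).
  move=> uv; have := xcov (Sub (u, v) uv).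
  rewrite /darc_tail /darc_head /x /incidence SubK !ffunE /=.
  by case: (u \in C); case: (v \in C) => //=; rewrite addr0 ler10.
move=> u v euv.
have nr : r1 != r by apply: contraTneq e_rr1 => ->; rewrite e_irr.
have nuv : u != v by apply: contraTneq euv => ->; rewrite e_irr.
have [uv|] := boolP ((u, v) \in darcs e r r1); first exact: arc.
have [vu|] := boolP ((v, u) \in darcs e r r1); first by rewrite orbC arc.
(* If both orientations were discarded, both ends would lie in {r, r1}; being distinct, they would
   be [r] and [r1], but the arc (r, r1) is kept. *)
rewrite !(in_darcs e_sym e_irr) // euv e_sym euv /=.
have [?|ur] := eqVneq u r; have [?|vr] := eqVneq v r; subst=> //=;
  rewrite ?eqxx // ?(negPf nr) ?implybT // in nuv *.
by have [?|] := eqVneq u r1; have [?|] := eqVneq v r1; subst; rewrite // eqxx in nuv.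
Qed.

Hypothesis z01 : forall a, z a = 0 \/ z a = 1.
Hypothesis zin : forall v, v != r -> v != r1 ->
  vsum z (darcs_in e r r1 v) = x v.
Hypothesis dinc : forall a : darc e r r1,
  #|T|%:R * (z a - 1) + d (darc_tail a) + x (darc_head a) <= d (darc_head a).
Hypothesis zx : forall a : darc e r r1,
  z a <= x (darc_tail a) /\ z a <= x (darc_head a).

(** The values of [z] on the arcs into [v] sum to 1, so some arc has [z a = 1]. On it the term with
    factor [#|T|] vanishes and [d] grows by at least [x v = 1], while [z a <= x (darc_tail a)] puts
    the tail in [C]. *)
Lemma selected_in_neighbor v : v \in C -> v != r -> v != r1 ->
  exists u, [/\ u \in C, e u v & d u < d v].
Proof.
move=> vC vr vr1.
have xv : x v = 1 by rewrite /x /incidence ffunE vC.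
have /existsP[a /andP[/eqP av za]] :
    [exists a : darc e r r1, (darc_head a == v) && (z a != 0)].
  apply: contra_eqT (zin vr vr1) => /existsPn noz.
  rewrite xv /vsum big1 1?eq_sym ?oner_eq0 // => a; rewrite inE => av.
  by have := noz a; rewrite av negbK => /eqP.
case: (z01 a) => za1; first by rewrite za1 eqxx in za.
have [zt _] := zx a; have := dinc a.
rewrite av xv za1 => da; exists (darc_tail a); split.
- move: zt; rewrite za1 /x /incidence ffunE.
  by case: (_ \in C) => //; rewrite ler10.
- have := valP a; rewrite [val a]surjective_pairing (in_darcs e_sym e_irr) //.
  by rewrite -/(darc_tail a) -/(darc_head a) av => /andP[].
- by lra.
Qed.

Lemma connected_of_darcs : connected_graph (induced e C).
Proof.
pose rt := if r \in C then r else r1.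
have symI : symmetric (induced e C) by move=> u v; exact: e_sym.
(* [rt] is reached by induction on the number of vertices with smaller [d]. *)
have toroot (v : {v | v \in C}) :
    exists2 w : {v | v \in C}, val w = rt & connect (induced e C) v w.
  have [n] := ubnP #|[set u | d u < d (val v)]|.
  elim: n v => // n IH v; rewrite ltnS => dn.
  have [vr|vr] := eqVneq (val v) r.
    by exists v; rewrite // /rt -vr (valP v).
  have [vr1|vr1] := eqVneq (val v) r1.
    rewrite /rt; case: ifP => rC; last by exists v.
    exists (Sub r rC); first by rewrite SubK.
    by apply: connect1; change (is_true (e (val v) r)); rewrite vr1 e_sym.
  have [u [uC uv duv]] := selected_in_neighbor (valP v) vr vr1.
  have [|w wrt cw] := IH (Sub u uC).
    (* The inclusion is strict because [u] lies below [v] but not below itself. *)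
    apply: leq_trans dn; apply: proper_card; apply/properP; split.
      by apply/subsetP => y; rewrite !inE => /lt_trans; apply; exact: duv.
    by exists u; rewrite !inE ?ltxx.
  exists w => //; apply: connect_trans cw.
  by apply: connect1; rewrite symI; exact: uv.
move=> u v; have [w wrt uw] := toroot u; have [w' wrt' vw] := toroot v.
have ww' : w' = w by apply: val_inj; rewrite wrt.
by apply: connect_trans uw _; rewrite (sym_connect_sym symI) -ww'.
Qed.

End Sufficiency.

Section Necessity.
Variables (R : realType) (T : finType) (e : rel T).
Hypotheses (e_sym : symmetric e) (e_irr : irreflexive e).
Variables (r r1 : T) (e_rr1 : e r r1) (C : {set T}).
Hypotheses (C_cover : vertex_cover e C).
Hypotheses (C_conn : connected_graph (induced e C)).
Let x := incidence R C.
Let root := if r \in C then r else r1.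

Let rootC : root \in C.
Proof. by rewrite /root; case: ifPn (C_cover e_rr1) => //= _. Qed.

Lemma spanning_tree : exists (f : T -> nat) (par : T -> T),
  [/\ f r = 0%N, forall v, (f v < #|T|)%N &
    forall v, v \in C -> v != root ->
      [/\ par v \in C, (par v, v) \in darcs e r r1 & (f (par v) < f v)%N]].
Proof.
have [f [f0 fP]] :=
  connect_rank [rel u v | [&& u \in C, v \in C & e u v]] root.
have conC v : v \in C ->
    connect [rel u v | [&& u \in C, v \in C & e u v]] root v.
  by move=> vC; exact: induced_connect (C_conn (Sub root rootC) (Sub v vC)).
(* Resetting the rank outside [C] gives [g r = 0] even when the root is [r1], and keeps [g] below
   [#|T|] where [f] has no known bound. *)
pose g v := if v \in C then f v else 0%N.
(* The arc (r, r1) is the only one that can enter r1. *)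
pose par v := if v == r1 then r else
  odflt v [pick u | [&& u \in C, e u v & (f u < f v)%N]].
exists g, par; split=> [|v|v vC vrt].
- by rewrite /g; case: ifP => rC //; rewrite -f0 /root rC.
- rewrite /g; case: ifP => [/conC/fP[] //|_].
  by apply/card_gt0P; exists r.
have [_ /(_ vrt)[u [_ /= /and3P[uC _ uv] fuv]]] := fP v (conC v vC).
have vr : v != r by apply: contraNneq vrt => vr; rewrite /root -vr vC vr.
rewrite (in_darcs e_sym e_irr) // vr /= /g vC /par.
have [v1|v1] := eqVneq v r1.
  (* A non-root [r1] in [C] forces the root to be [r], which has rank 0, while [f u < f r1] makes
     the rank of [r1] positive. *)
  have rC : r \in C by apply: contraNT vrt => rC; rewrite /root (negPf rC) v1.
  rewrite rC eqxx v1 e_rr1; split=> //.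
  have -> : f r = 0%N by rewrite -f0 /root rC.
  by rewrite -v1; apply: leq_ltn_trans fuv.
(* The search for a parent succeeds, since the predecessor [u] given by the rank qualifies. *)
case: pickP => [w /and3P[wC wv fw] /=|/(_ u)]; last by rewrite uC uv fuv.
by rewrite wC wv.
Qed.

Lemma darcs_solution :
  exists (z : {ffun darc e r r1 -> R}) (d : {ffun T -> R}),
    (forall a : darc e r r1, z a = 0 \/ z a = 1) /\
    (forall a : darc e r r1, 1 <= x (darc_tail a) + x (darc_head a)) /\
    (forall v : T, v != r -> v != r1 -> vsum z (darcs_in e r r1 v) = x v) /\
    (forall a : darc e r r1,
       #|T|%:R * (z a - 1) + d (darc_tail a) + x (darc_head a)
         <= d (darc_head a)) /\
    d r = 0 /\
    vsum z [set: darc e r r1] = vsum x [set: T] - 1 /\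
    (forall a : darc e r r1, z a <= x (darc_tail a) /\ z a <= x (darc_head a)).
Proof.
have [f [par [f0 fT parP]]] := spanning_tree.
pose sel (a : darc e r r1) := [&& darc_head a \in C, darc_head a != root
  & darc_tail a == par (darc_head a)].
pose z : {ffun darc e r r1 -> R} := [ffun a => (sel a)%:R].
(* One in-degree formula serves twice: away from [r] and [r1] the correction vanishes, which is
   (ii), and summing over all [v] subtracts exactly 1, which is (v). *)
have zin v : vsum z (darcs_in e r r1 v) = x v - (v == root)%:R.
  rewrite /vsum /x /incidence ffunE.
  have [vrt|vrt] := eqVneq v root.
    rewrite vrt rootC subrr big1 // => a; rewrite inE => /eqP av.
    by rewrite ffunE /sel av eqxx andbF.
  rewrite subr0; case: (boolP (v \in C)) => vC; last first.
    rewrite big1 // => a; rewrite inE => /eqP av.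
    by rewrite ffunE /sel av (negPf vC).
  have [_ pv _] := parP v vC vrt.
  rewrite (bigD1 (Sub (par v, v) pv)) /=; last by rewrite inE /darc_head SubK.
  rewrite ffunE /sel /darc_head /darc_tail SubK /= vC vrt eqxx /=.
  rewrite big1 ?addr0 // => a; rewrite inE => /andP[/eqP av na].
  rewrite ffunE; case: (boolP (sel a)) => // /and3P[_ _ /eqP ta].
  rewrite av in ta; case/eqP: na.
  apply: val_inj; rewrite SubK; move: av ta; rewrite /darc_tail /darc_head.
  by case: (val a) => t h /= -> ->.
exists z, [ffun v => (f v)%:R]; split.
  by move=> a; rewrite ffunE; case: (sel a); [right|left].
split.
  move=> a; have := valP a; rewrite [val a]surjective_pairing.
  rewrite (in_darcs e_sym e_irr) // => /and3P[/C_cover + _ _].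
  rewrite /x /incidence !ffunE -/(darc_tail a) -/(darc_head a).
  by case: (_ \in C); case: (_ \in C); rewrite //= ?addr0 ?add0r // lerDl ler01.
split.
  move=> v vr vr1; rewrite zin /root.
  by case: ifP; rewrite ?(negPf vr) ?(negPf vr1) subr0.
split.
  move=> a; rewrite !ffunE.
  have xle1 : ((darc_head a \in C)%:R : R) <= 1 by rewrite lern1 leq_b1.
  case: (boolP (sel a)) => [/and3P[hC hrt /eqP ->]|_].
    have [_ _ fp] := parP _ hC hrt.
    rewrite subrr mulr0 add0r; apply: le_trans (lerD (lexx _) xle1) _.
    by rewrite natr1 ler_nat.
  (* On an unselected arc the left side is at most 0: ranks are below [#|T|], so the rank of the
     tail plus 1 is at most [#|T|]. *)
  rewrite sub0r mulrN1.
  have f1 : (f (darc_tail a)).+1%:R <= #|T|%:R :> R by rewrite ler_nat.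
  have f2 : 0 <= (f (darc_head a))%:R :> R by [].
  by move: f1; rewrite -natr1; lra.
split; first by rewrite ffunE f0.
split.
  rewrite sum_darcs_into; under eq_bigr do rewrite zin.
  rewrite big_split /= sumrN.
  congr (_ - _); first by apply: eq_bigl => v; rewrite inE.
  rewrite (bigD1 root) //= eqxx big1 ?addr0 // => v /negPf -> //.
move=> a; rewrite !ffunE; case: (boolP (sel a)) => [/and3P[hC hrt /eqP ta]|_].
  by have [pC _ _] := parP _ hC hrt; rewrite ta hC pC.
by [].
Qed.

End Necessity.

Theorem theorem1 (R : realType) (T : finType) (e : rel T)
    (e_sym : symmetric e) (e_irr : irreflexive e)
    (e_conn : connected_graph e)
    (r r1 : T) (e_rr1 : e r r1) (C : {set T}) :
  connected_vertex_cover e C <->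
  exists (z : {ffun darc e r r1 -> R}) (d : {ffun T -> R}),
    let x := incidence R C in
    (forall a : darc e r r1, z a = 0 \/ z a = 1) /\
    (forall a : darc e r r1, 1 <= x (darc_tail a) + x (darc_head a)) /\
    (forall v : T, v != r -> v != r1 -> vsum z (darcs_in e r r1 v) = x v) /\
    (forall a : darc e r r1,
       #|T|%:R * (z a - 1) + d (darc_tail a) + x (darc_head a)
         <= d (darc_head a)) /\
    d r = 0 /\
    vsum z [set: darc e r r1] = vsum x [set: T] - 1 /\
    (forall a : darc e r r1, z a <= x (darc_tail a) /\ z a <= x (darc_head a)).
Proof.
split=> [[Ccov Ccon]|[z [d [z01 [xcov [zin [dinc [_ [_ zx]]]]]]]]].
  exact: darcs_solution.
split; first exact: (vertex_cover_of_darcs e_sym e_irr e_rr1 xcov).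
exact: (connected_of_darcs e_sym e_irr e_rr1 z01 zin dinc zx).
Qed.
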